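(* Let $d\in\{1,2,3\}$ and consider the $d$-dimensional special relativistic hydrodynamics (RHD) system with an equation of state $h=h(\theta)=1+e(\theta)+\theta$, $\theta=p/\rho$, satisfying $e'(\theta)>0$ and $h(\theta)>\theta(1+e'(\theta))/e'(\theta)$ for all $\theta>0$. Define $$S:=-\ln\rho+\int^{\theta}\frac{e'(x)}{x}\,dx,\qquad \eta(\mathbf U):=-DS,\qquad \mathbf q(\mathbf U):=-DS\,\mathbf v .$$ Then $(\eta(\mathbf U),\mathbf q(\mathbf U))$ is an entropy pair for the RHD system, i.e. $$\left(\frac{\partial\eta}{\partial\mathbf U}\right)^{\!\top}\frac{\partial\mathbf F_i}{\partial\mathbf U}=\left(\frac{\partial q_i}{\partial\mathbf U}\right)^{\!\top},\qquad i=1,\dots,d .$$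
   Context: The RHD system is $\partial_t\mathbf U+\sum_{i=1}^d\partial_{x_i}\mathbf F_i(\mathbf U)=\mathbf 0$ with conservative variables $\mathbf U=(D,\mathbf m^\top,E)^\top\in\mathbb R^{d+2}$ and fluxes $\mathbf F_i(\mathbf U)=(Dv_i,\ v_i\mathbf m^\top+p\,\mathbf e_i^\top,\ m_i)^\top$, where $D=\rho\gamma$, $\mathbf m=\rho h\gamma^2\mathbf v$, $E=\rho h\gamma^2-p$. Here $\rho>0$ is the rest-mass density, $p>0$ the pressure, $\mathbf v=(v_1,\dots,v_d)^\top$ with $|\mathbf v|<1$ the velocity, $\gamma=(1-|\mathbf v|^2)^{-1/2}$ the Lorentz factor, $\mathbf e_i$ the $i$-th column of the $d\times d$ identity matrix, $h$ the specific enthalpy, $e$ the specific internal energy, and $\theta:=p/\rho>0$. The equation of state is of ''Synge type'': $h=h(\theta)=1+e(\theta)+\theta$ with $e$ a continuously differentiable function of $\theta\in(0,\infty)$. $\int^\theta \frac{e'(x)}{x}dx$ denotes a fixed antiderivative of $e'(\theta)/\theta$. All quantities are explicit functions of the primitive variables $\mathbf V=(\rho,\mathbf v^\top,p)^\top$; they are regarded as functions of $\mathbf U$ through the change of variables $\mathbf V\leftrightarrow\mathbf U$, so that $\partial(\cdot)/\partial\mathbf U=\partial(\cdot)/\partial\mathbf V\,(\partial\mathbf U/\partial\mathbf V)^{-1}$. *)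

(* Defs.v *)
From HB Require Import structures.
From mathcomp Require Import all_boot all_order all_algebra.
From mathcomp Require Import all_classical all_reals all_analysis.

Set Implicit Arguments.
Unset Strict Implicit.
Unset Printing Implicit Defensive.

Import Order.TTheory GRing.Theory Num.Theory.
Import numFieldNormedType.Exports.

Local Open Scope ring_scope.

(* Vectors of R^(d+2) with a leading scalar, a d-vector and a trailing scalar:
   the primitive variables (rho, v, p) and the conservative ones (D, m, E). *)
Notation state R d := 'rV[R]_(1 + (d + 1)).

Definition mkstate (R : realType) (d : nat) (a : R) (w : 'rV[R]_d) (b : R) :
    state R d :=
  row_mx a%:M (row_mx w b%:M).

Section Primitive.
Context {R : realType} {d : nat}.
Implicit Type V : state R d.

Definition rho V : R := lsubmx V 0 0.
Definition vel V : 'rV[R]_d := lsubmx (rsubmx V).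
Definition prs V : R := rsubmx (rsubmx V) 0 0.

(* The Euclidean norm; the library norm `|v| of a row vector is the sup norm. *)
Definition enorm (v : 'rV[R]_d) : R := Num.sqrt (\sum_j v 0 j ^+ 2).

Definition admissible V : Prop := [/\ 0 < rho V, enorm (vel V) < 1 & 0 < prs V].

Definition theta V : R := prs V / rho V.
Definition lorentz V : R := (Num.sqrt (1 - enorm (vel V) ^+ 2))^-1.

End Primitive.

Definition enthalpy (R : realType) (e : R -> R) (th : R) : R := 1 + e th + th.

(* Only the values of e on (0, +oo) matter. *)
Definition C1_pos (R : realType) (e : R -> R) : Prop :=
  forall th : R, 0 < th -> derivable e th 1 /\ {for th, continuous (derive1 e)}.

(* Phi is an antiderivative of e'(x)/x on (0, +oo). *)
Definition entropy_antiderivative (R : realType) (e Phi : R -> R) : Prop :=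
  forall th : R, 0 < th -> is_derive th 1 Phi (derive1 e th / th).

Section RHD.
Context {R : realType} {d : nat} (e : R -> R).
Implicit Type V : state R d.

Definition massD V : R := rho V * lorentz V.

Definition momentum V : 'rV[R]_d :=
  (rho V * enthalpy e (theta V) * lorentz V ^+ 2) *: vel V.

Definition energy V : R :=
  rho V * enthalpy e (theta V) * lorentz V ^+ 2 - prs V.

Definition conserved V : state R d := mkstate (massD V) (momentum V) (energy V).

Definition flux (i : 'I_d) V : state R d :=
  mkstate (massD V * vel V 0 i)
          (vel V 0 i *: momentum V + prs V *: delta_mx 0 i)
          (momentum V 0 i).

(* The library jacobian acts on row vectors from the right; DV is its transpose,
   so that (DV f V) k j is the partial derivative of f_k along V_j. *)
Definition DV (n : nat) (f : state R d -> 'rV[R]_n) V : 'M[R]_(n, 1 + (d + 1)) :=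
  (jacobian f V)^T.

(* df/dU = df/dV (dU/dV)^-1, for f given in terms of the primitive variables V;
   invmx is a genuine inverse only when DV conserved V is invertible. *)
Definition DU (n : nat) (f : state R d -> 'rV[R]_n) V : 'M[R]_(n, 1 + (d + 1)) :=
  DV f V *m invmx (DV conserved V).

Definition scalar_fun (f : state R d -> R) : state R d -> 'rV[R]_1 :=
  fun V => (f V)%:M.

Definition gradU (f : state R d -> R) V : 'cV[R]_(1 + (d + 1)) :=
  (DU (scalar_fun f) V)^T.

(* Besides the compatibility relation, we require that all the derivatives with
   respect to U exist, so that none of them is a default value. *)
Definition entropy_pair (eta : state R d -> R) (q : state R d -> 'rV[R]_d) : Prop :=
  forall V, admissible V ->
    [/\ differentiable conserved V,
        DV conserved V \in unitmx,
        differentiable (scalar_fun eta) V &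
        forall i : 'I_d,
          [/\ differentiable (flux i) V,
              differentiable (scalar_fun (fun W => q W 0 i)) V &
              (gradU eta V)^T *m DU (flux i) V = (gradU (fun W => q W 0 i) V)^T]].

Variable Phi : R -> R.

Definition entropyS V : R := - ln (rho V) + Phi (theta V).
Definition entropy_eta V : R := - massD V * entropyS V.
Definition entropy_q V : 'rV[R]_d := (- massD V * entropyS V) *: vel V.

End RHD.

(* Main.v *)
Require Import Defs.
From HB Require Import structures.
From mathcomp Require Import all_boot all_order all_algebra.
From mathcomp Require Import all_classical all_reals all_analysis.
From mathcomp Require Import ring.

Set Implicit Arguments.
Unset Strict Implicit.
Unset Printing Implicit Defensive.

Import Order.TTheory GRing.Theory Num.Theory.
Import numFieldNormedType.Exports.
Local Open Scope ring_scope.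

(** The map from the primitive variables V to the conserved variables U is
differentiated by hand: the differential of every quantity is written as an
explicit function of a tangent vector H = (drho, dv, dp), and the library
differential is shown to be that function.  With theta = p / rho, h the
enthalpy and g the Lorentz factor, everything then rests on the Gibbs relation
  theta dS = dh - dp / rho
([gibbs_relation]), which is what the choice of the integrand e'(x) / x in S
is made for.  Together with v.v = 1 - g^-2 it becomes, in conserved variables,
  h dD + g v.dm - g dE = - D theta dS
([conserved_gibbs]), and two facts follow.

Compatibility.  Division by theta shows that the row
  w = (h / theta - S, g v / theta, - g / theta)
satisfies w.dU = - S dD - D dS = d eta ([entropy_vars_conserved]): it is the
vector of entropy variables.  The flux F_i is v_i U up to the pressure terms,
so w.dF_i = v_i d eta plus a multiple of dv_i, and the latter adds up to
eta dv_i, whence w.dF_i = dq_i ([entropy_vars_flux]).  As matrices,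
w U' = eta' and w F_i' = q_i', so that eta' U'^-1 F_i' U'^-1 = q_i' U'^-1 as
soon as U' is invertible.

Invertibility of U' ([dconserved_inj]).  Assume dU = 0.  The displayed
identity gives dS = 0.  With G = rho h g^2, dE = 0 gives dG = dp, then dm = 0
gives dv = - (dp / G) v and dD = 0 gives h drho = |v|^2 dp.  Inserted in
dS = 0 these leave (h e' - theta (1 + e') |v|^2) dp = 0.  The assumption on
the enthalpy says h e' > theta (1 + e'), and |v| < 1, so dp = 0, and then dv
and drho vanish as well. *)

(** * Differential calculus for real and row-vector valued maps *)

Section Differentials.
Context {R : realType} {V : normedModType R}.
Implicit Types (f g df dg : V -> R) (x : V).

(** The library states the rules of calculus for sums and products in the ring
of functions; the pointwise forms below let the function and its differential
be read off by unification. *)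
Lemma is_diff_add f g df dg x : is_diff x f df -> is_diff x g dg ->
  is_diff x (fun W => f W + g W) (fun H => df H + dg H).
Proof. exact: is_diffD. Qed.

Lemma is_diff_opp f df x : is_diff x f df ->
  is_diff x (fun W => - f W) (fun H => - df H).
Proof. exact: is_diffN. Qed.

Lemma is_diff_mul f g df dg x : is_diff x f df -> is_diff x g dg ->
  is_diff x (fun W => f W * g W) (fun H => f x * dg H + g x * df H).
Proof. exact: is_diffM. Qed.

Lemma is_diff_chain (phi : R -> R) (phi' : R) f df x :
  is_derive (f x) 1 phi phi' -> is_diff x f df ->
  is_diff x (fun W => phi (f W)) (fun H => phi' * df H).
Proof.
move=> [phi_drv phi_val] f_diff.
have phi_diff : is_diff (f x) phi ( *%R^~ phi').
  apply: DiffDef; first exact/derivable1_diffP.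
  by rewrite deriv1E// derive1E phi_val.
have comp_diff : is_diff x (phi \o f) ( *%R^~ phi' \o df).
  exact: is_diff_comp.
apply: (is_diff_eq comp_diff).
by apply/funext => H /=; rewrite mulrC.
Qed.

Lemma is_diff_coord n (f df : V -> 'rV[R]_n) x j : is_diff x f df ->
  is_diff x (fun W => f W 0 j) (fun H => df H 0 j).
Proof.
move=> f_diff.
pose c (M : 'rV[R]_n) := M 0 j.
have c_lin : linear c by move=> a A B; rewrite /c !mxE.
pose cL : {linear 'rV[R]_n -> R} :=
  HB.pack c (GRing.isLinear.Build _ _ _ _ c c_lin).
have c_diff : is_diff (f x) cL cL.
  by apply: DiffDef; [apply: linear_differentiable|apply: diff_lin];
    exact: coord_continuous.
have comp_diff : is_diff x (cL \o f) (cL \o df) by exact: is_diff_comp.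
exact: comp_diff.
Qed.

(** Conversely to [is_diff_coord], the differential of a row-vector valued map
may be computed entrywise, because such a map is the finite sum of its
coordinates times the vectors of the canonical basis. *)
Lemma is_diff_rV n (f df : V -> 'rV[R]_n) x :
  (forall j, is_diff x (fun W => f W 0 j) (fun H => df H 0 j)) ->
  is_diff x f df.
Proof.
move=> f_diff.
have f_differentiable : differentiable f x.
  have -> : f = \sum_(j < n) (fun W => f W 0 j *: delta_mx 0 j).
    by apply/funext => W; rewrite fct_sumE [LHS]row_sum_delta.
  apply: differentiable_sum => j; apply: differentiableZl.
  exact: (@ex_diff _ _ _ _ _ _ _ (f_diff j)).
apply: DiffDef => //; apply/funext => H; apply/rowP => j.
have fx : is_diff x f ('d f x) by exact: DiffDef.
have [_ coordE] := is_diff_coord j fx.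
by have [_] := f_diff j; rewrite coordE => /(congr1 (@^~ H)).
Qed.

End Differentials.

Lemma is_diff_sum (R : realType) (V : normedModType R) n
    (f df : 'I_n -> V -> R) (x : V) :
  (forall i, is_diff x (f i) (df i)) ->
  is_diff x (fun W => \sum_(i < n) f i W) (fun H => \sum_(i < n) df i H).
Proof.
elim: n f df => [|n IH] f df f_diff.
  under eq_fun do rewrite big_ord0.
  under [X in is_diff _ _ X]eq_fun do rewrite big_ord0.
  exact: is_diff_cst.
under eq_fun do rewrite big_ord_recr.
under [X in is_diff _ _ X]eq_fun do rewrite big_ord_recr.
by apply: is_diff_add => //; apply: IH.
Qed.

Lemma is_diff_scale (R : realType) (V : normedModType R) n
    (k dk : V -> R) (f df : V -> 'rV[R]_n) (x : V) :
  is_diff x k dk -> is_diff x f df ->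
  is_diff x (fun W => k W *: f W) (fun H => k x *: df H + dk H *: f x).
Proof.
move=> k_diff f_diff; apply: is_diff_rV => j.
have -> : (fun W => (k W *: f W) 0 j) = (fun W => k W * f W 0 j).
  by apply/funext => W; rewrite mxE.
apply: (is_diff_eq (is_diff_mul k_diff (is_diff_coord j f_diff))).
by apply/funext => H; rewrite !mxE [f x 0 j * _]mulrC.
Qed.

(** * The Euclidean scalar product and block row vectors *)

Definition dot (R : realType) d (v w : 'rV[R]_d) : R := \sum_j v 0 j * w 0 j.

Section Dot.
Context {R : realType} {d : nat}.
Implicit Types (v w u : 'rV[R]_d) (a : R).

Lemma dotC v w : dot v w = dot w v.
Proof. by apply: eq_bigr => j _; rewrite mulrC. Qed.

Lemma dotDr v w u : dot v (w + u) = dot v w + dot v u.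
Proof. by rewrite -big_split; apply: eq_bigr => j _; rewrite mxE mulrDr. Qed.

Lemma dotZr a v w : dot v (a *: w) = a * dot v w.
Proof. by rewrite mulr_sumr; apply: eq_bigr => j _; rewrite mxE mulrCA. Qed.

Lemma dotZl a v w : dot (a *: v) w = a * dot v w.
Proof. by rewrite dotC dotZr dotC. Qed.

Lemma dot_delta v i : dot v (delta_mx 0 i) = v 0 i.
Proof.
rewrite /dot (bigD1 i) //= mxE !eqxx mulr1 big1 ?addr0// => j /negPf ji.
by rewrite mxE ji andbF mulr0.
Qed.

Lemma enorm_sqr v : enorm v ^+ 2 = dot v v.
Proof.
rewrite /enorm sqr_sqrtr; first by apply: eq_bigr => j _; rewrite expr2.
by apply: sumr_ge0 => j _; rewrite sqr_ge0.
Qed.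

Lemma mkstate_mul a b v (a' b' : R) w :
  mkstate a v b *m (mkstate a' w b')^T = (a * a' + dot v w + b * b')%:M.
Proof.
rewrite /mkstate !tr_row_mx !mul_row_col !tr_scalar_mx -!scalar_mxM.
suff -> : v *m w^T = (dot v w)%:M by rewrite -!raddfD addrA.
apply/matrixP => i j; rewrite !ord1 !mxE eqxx mulr1n.
by apply: eq_bigr => k _; rewrite mxE.
Qed.

Lemma mkstate_eq0 a v b : mkstate a v b = 0 -> [/\ a = 0, v = 0 & b = 0].
Proof.
rewrite /mkstate -row_mx0 => /eq_row_mx [a0].
rewrite -row_mx0 => /eq_row_mx [v0 b0]; split=> //.
- by move/matrixP/(_ 0 0): a0; rewrite !mxE eqxx mulr1n.
- by move/matrixP/(_ 0 0): b0; rewrite !mxE eqxx mulr1n.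
Qed.

Lemma state_eq0 (H : state R d) : rho H = 0 -> vel H = 0 -> prs H = 0 -> H = 0.
Proof.
rewrite /rho /vel /prs => r0 v0 p0.
rewrite -[H]hsubmxK -[rsubmx H]hsubmxK.
rewrite [lsubmx H]mx11_scalar [rsubmx (rsubmx H)]mx11_scalar r0 v0 p0.
by rewrite !raddf0 !row_mx0.
Qed.

End Dot.

(** * Jacobian matrices through their action on tangent vectors *)

Lemma is_diff_mkstate (R : realType) (V : normedModType R) d
    (a da b db : V -> R) (w dw : V -> 'rV[R]_d) (x : V) :
  is_diff x a da -> is_diff x w dw -> is_diff x b db ->
  is_diff x (fun W => mkstate (a W) (w W) (b W))
    (fun H => mkstate (da H) (dw H) (db H)).
Proof.
move=> a_diff w_diff b_diff; apply: is_diff_rV => j.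
rewrite /mkstate.
case: (splitP j) => [j0 jE|k jE].
  have -> : j = lshift (d + 1) j0 by exact: val_inj.
  by under eq_fun do rewrite row_mxEl ord1 mxE eqxx mulr1n;
     under [X in is_diff _ _ X]eq_fun do rewrite row_mxEl ord1 mxE eqxx mulr1n.
have -> : j = rshift 1 k by exact: val_inj.
under eq_fun do rewrite row_mxEr.
under [X in is_diff _ _ X]eq_fun do rewrite row_mxEr.
case: (splitP k) => [k0 kE|k0 kE].
  have -> : k = lshift 1 k0 by exact: val_inj.
  under eq_fun do rewrite row_mxEl.
  under [X in is_diff _ _ X]eq_fun do rewrite row_mxEl.
  exact: is_diff_coord.
have -> : k = rshift d k0 by exact: val_inj.
by under eq_fun do rewrite row_mxEr ord1 mxE eqxx mulr1n;
   under [X in is_diff _ _ X]eq_fun do rewrite row_mxEr ord1 mxE eqxx mulr1n.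
Qed.

Lemma is_diff_scalar_fun (R : realType) d (f df : state R d -> R) V :
  is_diff V f df -> is_diff V (scalar_fun f) (scalar_fun df).
Proof.
move=> f_diff; apply: is_diff_rV => j; rewrite ord1 /scalar_fun.
by under eq_fun do rewrite mxE eqxx mulr1n;
   under [X in is_diff _ _ X]eq_fun do rewrite mxE eqxx mulr1n.
Qed.

Lemma DV_mul (R : realType) d n (f df : state R d -> 'rV[R]_n) V
  (H : state R d) : is_diff V f df -> DV f V *m H^T = (df H)^T.
Proof.
move=> f_diff; rewrite /DV /jacobian -trmx_mul mul_rV_lin1.
by rewrite (@diff_val _ _ _ _ _ _ _ f_diff).
Qed.

(** A relation between Jacobian matrices holds as soon as it holds for the
differentials along every tangent vector; this is what allows all the
computations to be carried out on differentials. *)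
Lemma mul_DV (R : realType) d m n (w : 'M[R]_(m, n))
    (f df : state R d -> 'rV[R]_n) (g dg : state R d -> 'rV[R]_m) V :
  is_diff V f df -> is_diff V g dg ->
  (forall H, w *m (df H)^T = (dg H)^T) -> w *m DV f V = DV g V.
Proof.
move=> f_diff g_diff w_df; apply: (can_inj trmxK); apply/row_matrixP => j.
rewrite !rowE; apply: trmx_inj; rewrite [LHS]trmx_mul [RHS]trmx_mul !trmxK.
by rewrite -mulmxA (DV_mul _ f_diff) (DV_mul _ g_diff).
Qed.

(** If w is the derivative of eta with respect to U, composing it with the
Jacobian of F in V gives the derivative of q in V, and U'^-1 converts both
sides to derivatives in U. *)
Lemma gradU_mul_DU (R : realType) d (e : R -> R) (w : 'rV[R]_(1 + (d + 1)))
    (eta q : state R d -> R) (F : state R d -> 'rV[R]_(1 + (d + 1))) V :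
  DV (conserved e) V \in unitmx ->
  w *m DV (conserved e) V = DV (scalar_fun eta) V ->
  w *m DV F V = DV (scalar_fun q) V ->
  (gradU e eta V)^T *m DU e F V = (gradU e q V)^T.
Proof.
move=> U_unit w_eta w_q.
rewrite /gradU [X in X *m _]trmxK [RHS]trmxK /DU -w_eta -w_q.
(* Kept as terms, the Jacobians would be unfolded in the search for invmx. *)
move: (DV (conserved e) V) (DV F V) U_unit => dU dF dU_unit.
by rewrite mulmxK// mulmxA.
Qed.

(** * Differentials of the temperature and of the Lorentz factor *)

Section PrimitiveDifferentials.
Context {R : realType} {d : nat}.
Implicit Types (V H : state R d).

(** The primitive variables are linear in V, hence their own differentials. *)
Lemma is_diff_rho V : is_diff V (@rho R d) (@rho R d).
Proof.
have -> : @rho R d = fun W => W 0 (lshift (d + 1) 0).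
  by apply/funext => W; rewrite /rho mxE.
exact: (is_diff_coord _ (is_diff_id V)).
Qed.

Lemma is_diff_prs V : is_diff V (@prs R d) (@prs R d).
Proof.
have -> : @prs R d = fun W => W 0 (rshift 1 (rshift d 0)).
  by apply/funext => W; rewrite /prs !mxE.
exact: (is_diff_coord _ (is_diff_id V)).
Qed.

Lemma is_diff_vel V : is_diff V (@vel R d) (@vel R d).
Proof.
apply: is_diff_rV => j.
have -> : (fun W : state R d => vel W 0 j) =
    fun W => W 0 (rshift 1 (lshift 1 j)).
  by apply/funext => W; rewrite /vel !mxE.
exact: (is_diff_coord _ (is_diff_id V)).
Qed.

Lemma admissible_theta_gt0 V : admissible V -> 0 < theta V.
Proof. by case=> r0 _ p0; rewrite divr_gt0. Qed.

Lemma admissible_speed V : admissible V -> dot (vel V) (vel V) < 1.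
Proof.
by case=> _ v1 _; rewrite -enorm_sqr expr_lt1// sqrtr_ge0.
Qed.

Lemma lorentzE V : lorentz V = (Num.sqrt (1 - dot (vel V) (vel V)))^-1.
Proof. by rewrite /lorentz enorm_sqr. Qed.

Lemma lorentz_gt0 V : admissible V -> 0 < lorentz V.
Proof.
by move=> /admissible_speed v1; rewrite lorentzE invr_gt0 sqrtr_gt0 subr_gt0.
Qed.

Lemma dot_vel V : admissible V -> dot (vel V) (vel V) = 1 - (lorentz V) ^- 2.
Proof.
move=> /admissible_speed v1.
by rewrite lorentzE exprVn invrK sqr_sqrtr ?subKr// subr_ge0 ltW.
Qed.

Definition dtheta V H : R := (prs H - theta V * rho H) / rho V.

Lemma is_diff_theta V : admissible V -> is_diff V (@theta R d) (dtheta V).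
Proof.
case=> r0 _ _; have rN0 : rho V != 0 by rewrite gt_eqF.
have inv_drv : is_derive (rho V) 1 (fun y : R => y^-1) (- (rho V) ^- 2 *: 1).
  exact: is_deriveV.
apply: (is_diff_eq (is_diff_mul (is_diff_prs V)
  (is_diff_chain inv_drv (is_diff_rho V)))).
by apply/funext => H; rewrite /dtheta /theta scaler1; field.
Qed.

Definition dlorentz V H : R := lorentz V ^+ 3 * dot (vel V) (vel H).

Lemma is_diff_dot_vel V : is_diff V (fun W : state R d => dot (vel W) (vel W))
  (fun H => 2 * dot (vel V) (vel H)).
Proof.
apply: (is_diff_eq (is_diff_sum (fun j => is_diff_mul
  (is_diff_coord j (is_diff_vel V)) (is_diff_coord j (is_diff_vel V))))).
apply/funext => H; rewrite /dot mulr_sumr; apply: eq_bigr => j _; ring.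
Qed.

Lemma is_diff_lorentz V : admissible V ->
  is_diff V (@lorentz R d) (dlorentz V).
Proof.
move=> V_adm; have v1 := admissible_speed V_adm.
have -> : @lorentz R d = fun W => (Num.sqrt (1 - dot (vel W) (vel W)))^-1.
  by apply/funext => W; exact: lorentzE.
set y := 1 - dot (vel V) (vel V).
have y0 : 0 < y by rewrite subr_gt0.
have sN0 : Num.sqrt y != 0 by rewrite gt_eqF// sqrtr_gt0.
have y_diff : is_diff V (fun W : state R d => 1 - dot (vel W) (vel W))
    (fun H => 0 - 2 * dot (vel V) (vel H)).
  exact: is_diff_add (is_diff_cst (1 : R) V) (is_diff_opp (is_diff_dot_vel V)).
have drv : is_derive y 1 (fun z => (Num.sqrt z)^-1)
    (- Num.sqrt y ^- 2 *: (2 * Num.sqrt y)^-1).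
  exact: is_deriveV (is_derive1_sqrt y0).
apply: (is_diff_eq (is_diff_chain
  (f := fun W : state R d => 1 - dot (vel W) (vel W)) drv y_diff)).
apply/funext => H; rewrite /dlorentz lorentzE -/y /GRing.scale /= sub0r.
by field.
Qed.

End PrimitiveDifferentials.

(** * Differentials of the conserved variables, the fluxes and the entropy *)

Section RHDDifferentials.
Context {R : realType} {d : nat} (e Phi : R -> R).
Hypothesis e_C1 : C1_pos e.
Hypothesis Phi_prim : entropy_antiderivative e Phi.
Implicit Types (V H : state R d).

Let h V := enthalpy e (theta V).
Let e' V := derive1 e (theta V).

(** The relativistic inertia rho h g^2: the momentum is inertia times velocity
and the energy is inertia minus pressure. *)
Definition inertia V : R := rho V * h V * lorentz V ^+ 2.

Definition dmassD V H : R := rho V * dlorentz V H + lorentz V * rho H.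

Definition denthalpy V H : R := (1 + e' V) * dtheta V H.

Definition dinertia V H : R :=
  rho V * h V * (2 * lorentz V * dlorentz V H)
  + lorentz V ^+ 2 * (rho V * denthalpy V H + h V * rho H).

Definition dmomentum V H : 'rV[R]_d :=
  inertia V *: vel H + dinertia V H *: vel V.

Definition denergy V H : R := dinertia V H - prs H.

Definition dentropy V H : R := - (rho H / rho V) + e' V / theta V * dtheta V H.

Definition dconserved V H : state R d :=
  mkstate (dmassD V H) (dmomentum V H) (denergy V H).

Definition dflux (i : 'I_d) V H : state R d :=
  mkstate (massD V * vel H 0 i + vel V 0 i * dmassD V H)
    (vel V 0 i *: dmomentum V H + vel H 0 i *: momentum e V
     + prs H *: delta_mx 0 i)
    (dmomentum V H 0 i).

Definition deta V H : R :=
  - massD V * dentropy V H - entropyS Phi V * dmassD V H.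

Definition dq (i : 'I_d) V H : R :=
  entropy_eta Phi V * vel H 0 i + vel V 0 i * deta V H.

Lemma is_diff_massD V : admissible V -> is_diff V (@massD R d) (dmassD V).
Proof.
by move=> V_adm; exact: is_diff_mul (is_diff_rho V) (is_diff_lorentz V_adm).
Qed.

Lemma is_diff_enthalpy V : admissible V -> is_diff V h (denthalpy V).
Proof.
move=> V_adm; have th0 := admissible_theta_gt0 V_adm.
have [e_drv _] := e_C1 th0.
have th_diff := is_diff_theta V_adm.
have drv : is_derive (theta V) 1 e (e' V).
  by apply: DeriveDef => //; rewrite /e' derive1E.
apply: (is_diff_eq (is_diff_add (is_diff_add (is_diff_cst (1 : R) V)
  (is_diff_chain drv th_diff)) th_diff)).
by apply/funext => H; rewrite /denthalpy add0r; ring.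
Qed.

Lemma is_diff_inertia V : admissible V -> is_diff V inertia (dinertia V).
Proof.
move=> V_adm; have g_diff := is_diff_lorentz V_adm.
have -> : inertia = fun W => rho W * h W * (lorentz W * lorentz W).
  by apply/funext => W; rewrite /inertia expr2.
apply: (is_diff_eq (is_diff_mul (is_diff_mul (is_diff_rho V)
  (is_diff_enthalpy V_adm)) (is_diff_mul g_diff g_diff))).
by apply/funext => H; rewrite /dinertia; ring.
Qed.

Lemma is_diff_momentum V : admissible V -> is_diff V (momentum e) (dmomentum V).
Proof.
by move=> V_adm; exact: is_diff_scale (is_diff_inertia V_adm) (is_diff_vel V).
Qed.

Lemma is_diff_conserved V : admissible V ->
  is_diff V (conserved e) (dconserved V).
Proof.
move=> V_adm; apply: is_diff_mkstate; first exact: is_diff_massD.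
  exact: is_diff_momentum.
exact: is_diff_add (is_diff_inertia V_adm) (is_diff_opp (is_diff_prs V)).
Qed.

Lemma is_diff_flux i V : admissible V -> is_diff V (flux e i) (dflux i V).
Proof.
move=> V_adm.
have v_diff := is_diff_coord i (is_diff_vel V).
have m_diff := is_diff_momentum V_adm.
apply: is_diff_mkstate; first exact: is_diff_mul (is_diff_massD V_adm) v_diff.
  apply: is_diff_rV => j.
  have mi_diff := is_diff_coord j (is_diff_scale v_diff m_diff).
  have pi_diff := is_diff_coord j (is_diff_scale (is_diff_prs V)
    (is_diff_cst (delta_mx 0 i : 'rV[R]_d) V)).
  have -> : (fun W => (vel W 0 i *: momentum e W + prs W *: delta_mx 0 i) 0 j)
    = fun W => (vel W 0 i *: momentum e W) 0 j
        + (prs W *: (delta_mx 0 i : 'rV[R]_d)) 0 j.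
    by apply/funext => W; rewrite mxE.
  apply: (is_diff_eq (is_diff_add mi_diff pi_diff)).
  by apply/funext => H; rewrite !mxE mulr0 add0r.
exact: is_diff_coord.
Qed.

Lemma is_diff_entropyS V : admissible V ->
  is_diff V (entropyS Phi) (dentropy V).
Proof.
move=> V_adm; have th0 := admissible_theta_gt0 V_adm; have [r0 _ _] := V_adm.
have th_diff := is_diff_theta V_adm.
apply: (is_diff_eq (is_diff_add
  (is_diff_opp (is_diff_chain (is_derive1_ln r0) (is_diff_rho V)))
  (is_diff_chain (Phi_prim th0) th_diff))).
by apply/funext => H; rewrite /dentropy [_^-1 * _]mulrC.
Qed.

Lemma is_diff_entropy_eta V : admissible V ->
  is_diff V (entropy_eta Phi) (deta V).
Proof.
move=> V_adm.
apply: (is_diff_eq (is_diff_mul (is_diff_opp (is_diff_massD V_adm))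
  (is_diff_entropyS V_adm))).
by apply/funext => H; rewrite mulrN.
Qed.

Lemma is_diff_entropy_q i V : admissible V ->
  is_diff V (fun W => entropy_q Phi W 0 i) (dq i V).
Proof.
move=> V_adm.
have -> : (fun W => entropy_q Phi W 0 i) =
    (fun W => entropy_eta Phi W * vel W 0 i).
  by apply/funext => W; rewrite mxE.
apply: is_diff_mul; first exact: is_diff_entropy_eta.
exact: is_diff_coord (is_diff_vel V).
Qed.

(** * Entropy variables and compatibility with the fluxes *)

(** The derivative of eta with respect to U, found by dividing
[conserved_gibbs] by the temperature. *)
Definition entropy_vars V : state R d :=
  mkstate (h V / theta V - entropyS Phi V)
    ((lorentz V / theta V) *: vel V) (- (lorentz V / theta V)).

(** The first law of thermodynamics.  The antiderivative contributes
e'(theta) dtheta = de to the left-hand side; the remaining - theta drho / rho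
is dtheta - dp / rho, because p = rho theta. *)
Lemma gibbs_relation V H : admissible V ->
  theta V * dentropy V H = denthalpy V H - prs H / rho V.
Proof.
case=> r0 _ p0.
rewrite /dentropy /denthalpy /dtheta /theta.
by field; rewrite !gt_eqF.
Qed.

(** The inertia G satisfies G = D h g, so that
g v.dm - g dE = g G v.dv - dG / g + g dp, where the variation of g in dG / g
cancels g G v.dv and the variation of D cancels h dD.  What remains is
- D dh + g dp, that is - D (dh - dp / rho). *)
Lemma conserved_gibbs V H : admissible V ->
  h V * dmassD V H + lorentz V * dot (vel V) (dmomentum V H)
    - lorentz V * denergy V H = - (massD V * (theta V * dentropy V H)).
Proof.
move=> V_adm; have [r0 _ _] := V_adm; have g0 := lorentz_gt0 V_adm.
rewrite gibbs_relation// /dmomentum dotDr !dotZr dot_vel//.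
rewrite /denergy /dinertia /inertia /dmassD /dlorentz /massD.
by field; rewrite !gt_eqF.
Qed.

Lemma entropy_vars_conserved V H : admissible V ->
  entropy_vars V *m (dconserved V H)^T = (deta V H)%:M.
Proof.
move=> V_adm; rewrite mkstate_mul dotZl; congr (_%:M).
have thN0 := lt0r_neq0 (admissible_theta_gt0 V_adm).
have -> : deta V H = - (massD V * (theta V * dentropy V H)) / theta V
    - entropyS Phi V * dmassD V H by rewrite /deta; field.
by rewrite -conserved_gibbs//; field.
Qed.

(** Only the variation of v_i distinguishes dF_i from v_i dU: the terms in dp
coming from the momentum flux compensate those of E = G - p, and the terms in
dv_i add up to (h / theta - S) D - g G (1 - v.v) / theta = - S D = eta. *)
Lemma entropy_vars_flux i V H : admissible V ->
  entropy_vars V *m (dflux i V H)^T = (dq i V H)%:M.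
Proof.
move=> V_adm; have := entropy_vars_conserved H V_adm.
rewrite !mkstate_mul => /matrixP/(_ 0 0) dE.
rewrite !mxE eqxx !mulr1n in dE.
congr (_%:M); rewrite /dq -dE.
have [r0 _ p0] := V_adm; have g0 := lorentz_gt0 V_adm.
have th0 := admissible_theta_gt0 V_adm.
(* The differential of m_i = G v_i, with dG written as dE + dp. *)
have -> : dmomentum V H 0 i =
    inertia V * vel H 0 i + (denergy V H + prs H) * vel V 0 i.
  by rewrite /denergy subrK [LHS]mxE; congr (_ + _); rewrite [LHS]mxE.
(* The rest of dm enters only through v.dm, which is the same on both sides. *)
rewrite !dotZl; move: (dmomentum V H) => dm.
rewrite !dotDr !dotZr dot_delta dot_vel//.
rewrite /entropy_eta /inertia /massD /h.
by field; rewrite !gt_eqF.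
Qed.

(** * Invertibility of the change of variables *)

Hypothesis e'_gt0 : forall th : R, 0 < th -> 0 < derive1 e th.
Hypothesis h_gt : forall th : R, 0 < th ->
  th * (1 + derive1 e th) / derive1 e th < enthalpy e th.

(** The variation of entropy is killed together with dU, so that the pressure
variation can be compared with the density variation in two ways: through
dS = 0 and through the kinematics dD = 0.  The bound on the enthalpy makes the
two incompatible unless dp = 0. *)
Lemma dconserved_inj V H : admissible V -> dconserved V H = 0 -> H = 0.
Proof.
move=> V_adm dU0.
have [r0 _ p0] := V_adm; have g0 := lorentz_gt0 V_adm.
have th0 := admissible_theta_gt0 V_adm.
have e'0 : 0 < e' V := e'_gt0 th0.
have hh : theta V * (1 + e' V) < h V * e' V by rewrite -ltr_pdivrMr// h_gt.
have h0 : 0 < h V.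
  rewrite -(pmulr_lgt0 _ e'0); apply: lt_trans hh.
  by rewrite mulr_gt0// addr_gt0.
have G0 : 0 < inertia V by rewrite !mulr_gt0// exprn_gt0.
have dS0 : dentropy V H = 0.
  have := conserved_gibbs H V_adm.
  have [-> -> ->] := mkstate_eq0 dU0.
  have -> : dot (vel V) 0 = 0 by rewrite -(scale0r 0) dotZr mul0r.
  rewrite !mulr0 addr0 subr0 => /esym/eqP.
  have D0 : 0 < massD V by exact: mulr_gt0.
  by rewrite oppr_eq0 mulf_eq0 (gt_eqF D0) mulf_eq0 (gt_eqF th0) => /eqP.
have [dD0 dm0 /subr0_eq dG] := mkstate_eq0 dU0.
have dv : vel H = - (prs H / inertia V) *: vel V.
  move/eqP: dm0; rewrite /dmomentum dG addr_eq0 => /eqP dm.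
  by rewrite -[LHS](scalerK (lt0r_neq0 G0)) dm scalerN scaleNr scalerA mulrC.
have drho : rho H * h V = dot (vel V) (vel V) * prs H.
  move: dD0; rewrite /dmassD /dlorentz dv dotZr => dD0.
  have : (rho H * h V - dot (vel V) (vel V) * prs H) * lorentz V = 0.
    rewrite -[RHS](mulr0 (h V)) -dD0 /inertia; field.
    by rewrite !gt_eqF.
  by move/eqP; rewrite mulf_eq0 (gt_eqF g0) orbF subr_eq0 => /eqP.
have dp : theta V * (1 + e' V) * rho H = e' V * prs H.
  have : rho V * theta V * dentropy V H = 0 by rewrite dS0 mulr0.
  rewrite /dentropy /dtheta => dS.
  apply/eqP; rewrite eq_sym -subr_eq0 -dS; apply/eqP; field.
  by rewrite !gt_eqF.
have p'0 : prs H = 0.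
  have : (h V * e' V - theta V * (1 + e' V) * dot (vel V) (vel V)) * prs H = 0.
    transitivity (h V * (e' V * prs H)
      - theta V * (1 + e' V) * (dot (vel V) (vel V) * prs H)); first by ring.
    by rewrite -dp -drho; ring.
  move/eqP; rewrite mulf_eq0 => /orP[|/eqP//].
  rewrite gt_eqF// subr_gt0; apply: le_lt_trans hh.
  by rewrite ler_piMr ?ltW ?admissible_speed// mulr_gt0// addr_gt0.
apply: state_eq0 => //; last by rewrite dv p'0 mul0r oppr0 scale0r.
by move/eqP: drho; rewrite p'0 mulr0 mulf_eq0 (gt_eqF h0) orbF => /eqP.
Qed.

Lemma DV_conserved_unit V : admissible V -> DV (conserved e) V \in unitmx.
Proof.
move=> V_adm; rewrite unitmx_tr -row_free_unit; apply: inj_row_free => H.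
rewrite -[H *m _]trmxK trmx_mul (DV_mul H (is_diff_conserved V_adm)) trmxK.
exact: dconserved_inj.
Qed.

End RHDDifferentials.

(** * The entropy pair *)

Theorem theorem1 (R : realType) (d : nat) (hd : (1 <= d <= 3)%N)
  (e Phi : R -> R)
  (e_C1 : C1_pos e)
  (e'_gt0 : forall th : R, 0 < th -> 0 < derive1 e th)
  (h_gt : forall th : R, 0 < th ->
     th * (1 + derive1 e th) / derive1 e th < enthalpy e th)
  (Phi_prim : entropy_antiderivative e Phi) :
  entropy_pair (d := d) e (entropy_eta Phi) (entropy_q Phi).
Proof.
move=> V V_adm.
have U_diff := is_diff_conserved e_C1 V_adm.
have eta_diff := is_diff_scalar_fun (is_diff_entropy_eta Phi_prim V_adm).
have U_unit := DV_conserved_unit e_C1 e'_gt0 h_gt V_adm.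
split=> // i.
have F_diff := is_diff_flux e_C1 i V_adm.
have q_diff := is_diff_scalar_fun (is_diff_entropy_q Phi_prim i V_adm).
split=> //.
apply: (gradU_mul_DU (w := entropy_vars e Phi V)) => //.
  apply: (mul_DV U_diff eta_diff) => H.
  by rewrite entropy_vars_conserved// tr_scalar_mx.
apply: (mul_DV F_diff q_diff) => H.
by rewrite entropy_vars_flux// tr_scalar_mx.
Qed.
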